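(* Let $A\in\mathbb{C}^{n\times n}$ be Hermitian and $B\in\mathbb{C}^{n\times n}$ be skew-Hermitian, and define $E:=AB-BA$ (which is then Hermitian). Then for every $i$, $$|\lambda_i(A+E)-\lambda_i(A)|\le\|B\|_2\,\|AB-BA\|_2=\|B\|_2\,\|E\|_2 .$$
   Context: $\|\cdot\|_2$ is the spectral norm. For a Hermitian matrix $M$, $\lambda_i(M)$ denotes its $i$-th eigenvalue, eigenvalues being listed with multiplicity in monotone order (the same order for $A$ and $A+E$). No assumption of simple eigenvalues is made. *)

(* Defs.v *)
From HB Require Import structures.
From mathcomp Require Import all_boot all_order all_algebra.
From mathcomp Require Import complex.
From mathcomp Require Import boolp classical_sets reals.

Set Implicit Arguments.
Unset Strict Implicit.
Unset Printing Implicit Defensive.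

Import Order.TTheory GRing.Theory Num.Theory.
Local Open Scope ring_scope.
Local Open Scope complex_scope.
Local Open Scope classical_set_scope.

(* Equal to minus its conjugate transpose: the sign in [hermitianmx eps theta] is (-1) ^+ eps. *)
Notation skewhermmx := (hermitianmx _ true Num.conj).

Section Definitions.
Context {R : realType}.

(* The roots of the characteristic polynomial, listed with multiplicity. *)
Definition eigenvalues n (M : 'M[R[i]]_n) : seq R[i] :=
  sval (closed_field_poly_normal (char_poly M)).

(* Indexed from 0 in nondecreasing order. For Hermitian M the eigenvalues are
   real, so taking real parts loses nothing: see [char_poly_lambda]. *)
Definition lambda n (M : 'M[R[i]]_n) (i : 'I_n) : R :=
  (sort <=%R [seq complex.Re z | z <- eigenvalues M])`_i.

Definition l2norm n (x : 'cV[R[i]]_n) : R :=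
  Num.sqrt (\sum_i Normc.normc (x i 0) ^+ 2).

(* The supremum is over the unit ball, not the unit sphere, so that the set is
   nonempty even when n = 0. *)
Definition specnorm m n (M : 'M[R[i]]_(m, n)) : R :=
  sup [set l2norm (M *m x) | x in [set x : 'cV[R[i]]_n | l2norm x <= 1]].

End Definitions.

Section Eigenvalues.
Context {R : realType}.

Lemma char_poly_eigenvalues n (M : 'M[R[i]]_n) :
  char_poly M = \prod_(z <- eigenvalues M) ('X - z%:P).
Proof.
rewrite /eigenvalues; case: (closed_field_poly_normal _) => r /= ->.
rewrite (monicP _) ?scale1r //.
exact: char_poly_monic.
Qed.

Lemma size_eigenvalues n (M : 'M[R[i]]_n) : size (eigenvalues M) = n.
Proof.
have := size_char_poly M.
by rewrite char_poly_eigenvalues size_prod_XsubC => -[].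
Qed.

Lemma lambda_nondecreasing n (M : 'M[R[i]]_n) (i j : 'I_n) :
  (i <= j)%N -> lambda M i <= lambda M j.
Proof.
move=> ij; apply: sorted_leq_nth => //; first exact: le_trans.
- exact/sort_sorted/le_total.
- by rewrite inE size_sort size_map size_eigenvalues.
- by rewrite inE size_sort size_map size_eigenvalues.
Qed.

Lemma eigenvalues_hermitian_real n (M : 'M[R[i]]_n) : M \is hermsymmx ->
  {in eigenvalues M, forall z, z \is Num.real}.
Proof.
move=> Mh z zM; have Dr := hermitian_spectral_diag_real Mh.
have /hermitian_normalmx/orthomx_spectralP Me := Mh.
have : eigenvalue M z.
  by rewrite eigenvalue_root_char char_poly_eigenvalues root_prod_XsubC.
case/eigenvalueP => v vM v0.
have Pu := spectral_unit M; set P := spectralmx M in Pu Me.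
set d := spectral_diag M in Dr Me.
have [w wE] : {w | w = v *m invmx P} by exists (v *m invmx P).
have w0 : w != 0.
  by apply: contraNneq v0 => w0; rewrite -(mulmxKV Pu v) -wE w0 mul0mx.
have : w *m diag_mx d = z *: w.
  apply: (can_inj (mulmxK Pu)); rewrite -[LHS]mulmxA wE -!mulmxA.
  by rewrite -scalemxAl mulmxKV // -vM [in RHS]Me !mulmxA.
move=> wd; have [j wj] : exists j, w 0 j != 0 by apply/rV0Pn.
have /rowP/(_ j) := wd; rewrite mul_mx_diag !mxE [LHS]mulrC => wdj.
by have <- := mulIf wj wdj; exact: (mxOverP Dr).
Qed.

Lemma char_poly_lambda n (M : 'M[R[i]]_n) : M \is hermsymmx ->
  char_poly M = \prod_(i < n) ('X - ((lambda M i)%:C)%:P).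
Proof.
move=> Mh; set s := sort <=%R [seq complex.Re z | z <- eigenvalues M].
have ss : size s = n by rewrite size_sort size_map size_eigenvalues.
transitivity (\prod_(x <- s) ('X - (x%:C)%:P : {poly R[i]})).
  rewrite (perm_big _ (permEl (perm_sort _ _))) big_map char_poly_eigenvalues.
  rewrite big_seq [RHS]big_seq; apply: eq_bigr => z zM.
  by rewrite RRe_real // (eigenvalues_hermitian_real Mh).
by rewrite (big_nth 0) ss big_mkord.
Qed.

End Eigenvalues.

Section SpectralNorm.
Context {R : realType}.
Implicit Types (m n : nat).

Lemma l2norm_ge0 n (x : 'cV[R[i]]_n) : 0 <= l2norm x.
Proof. exact: sqrtr_ge0. Qed.

Lemma normc_ge0 (z : R[i]) : 0 <= Normc.normc z.
Proof. by case: z => a b /=; exact: sqrtr_ge0. Qed.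

Lemma normc_le_l2norm n (x : 'cV[R[i]]_n) i : Normc.normc (x i 0) <= l2norm x.
Proof.
rewrite -[leLHS](ger0_norm (normc_ge0 _)) -sqrtr_sqr; apply: ler_wsqrtr.
rewrite (bigD1 i) //= lerDl; apply: sumr_ge0 => j _; exact: sqr_ge0.
Qed.

Lemma l2norm_eq0 n (x : 'cV[R[i]]_n) : l2norm x = 0 -> x = 0.
Proof.
move=> x0; apply/colP => i; rewrite mxE; apply: Normc.eq0_normc.
by apply/le_anti; rewrite normc_ge0 -x0 normc_le_l2norm.
Qed.

Lemma l2normZ n (a : R[i]) (x : 'cV[R[i]]_n) :
  l2norm (a *: x) = Normc.normc a * l2norm x.
Proof.
rewrite /l2norm -[X in X * _](ger0_norm (normc_ge0 _)) -sqrtr_sqr.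
rewrite -sqrtrM ?sqr_ge0 // mulr_sumr; congr Num.sqrt.
by apply: eq_bigr => i _; rewrite mxE Normc.normcM exprMn.
Qed.

Lemma l2norm0 n : l2norm (0 : 'cV[R[i]]_n) = 0.
Proof. by rewrite -(scale0r 0) l2normZ Normc.normc0 mul0r. Qed.

Lemma normc_sum n (F : 'I_n -> R[i]) :
  Normc.normc (\sum_i F i) <= \sum_i Normc.normc (F i).
Proof.
have := ler_norm_sum (index_enum 'I_n) F xpredT.
by rewrite -lecR rmorph_sum.
Qed.

Lemma specnorm_set_nonempty m n (M : 'M[R[i]]_(m, n)) :
  [set l2norm (M *m x) | x in [set x : 'cV[R[i]]_n | l2norm x <= 1]] !=set0.
Proof. by exists (l2norm (M *m 0)), 0 => //=; rewrite l2norm0 ler01. Qed.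

Lemma specnorm_set_bounded m n (M : 'M[R[i]]_(m, n)) :
  has_ubound
    [set l2norm (M *m x) | x in [set x : 'cV[R[i]]_n | l2norm x <= 1]].
Proof.
exists (Num.sqrt (\sum_i (\sum_j Normc.normc (M i j)) ^+ 2)) => _ [x /= x1 <-].
apply/ler_wsqrtr/ler_sum => i _; rewrite ler_pXn2r ?nnegrE ?normc_ge0 //.
  rewrite mxE; apply: le_trans (normc_sum _) _; apply: ler_sum => j _.
  rewrite Normc.normcM ler_piMr ?normc_ge0 //.
  exact: le_trans (normc_le_l2norm _ _) x1.
by apply: sumr_ge0 => j _; exact: normc_ge0.
Qed.

Lemma l2norm_mulmx m n (M : 'M[R[i]]_(m, n)) (x : 'cV[R[i]]_n) :
  l2norm (M *m x) <= specnorm M * l2norm x.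
Proof.
have [x0|x0] := eqVneq (l2norm x) 0.
  by rewrite x0 mulr0 (l2norm_eq0 x0) mulmx0 l2norm0.
have xp : 0 < l2norm x by rewrite lt0r x0 l2norm_ge0.
have nV : Normc.normc ((l2norm x)^-1)%:C = (l2norm x)^-1.
  by rewrite /= expr0n addr0 sqrtr_sqr ger0_norm // invr_ge0 l2norm_ge0.
rewrite -ler_pdivrMr // mulrC -nV -l2normZ -linearZ /=.
apply: (ub_le_sup (specnorm_set_bounded M)).
by exists (((l2norm x)^-1)%:C *: x) => //=; rewrite l2normZ nV mulVf.
Qed.

Lemma specnorm_le m n (M : 'M[R[i]]_(m, n)) (c : R) : 0 <= c ->
  (forall x : 'cV[R[i]]_n, l2norm (M *m x) <= c * l2norm x) -> specnorm M <= c.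
Proof.
move=> c0 Mc; apply: ge_sup; first exact: specnorm_set_nonempty.
by move=> _ [x /= x1 <-]; apply: le_trans (Mc x) _; rewrite ler_piMr.
Qed.

End SpectralNorm.

(* Main.v *)
(* With [C = B / 2], the Cayley transform [U = (1 + C) (1 - C)^-1] is unitary,
   so [A' = U^* A U] has the eigenvalues of [A]. Multiplying out gives
   [A + E - A' = E - (1 + C)^-1 E (1 - C)^-1], that is
   [(1 + C)^-1 C E - (1 + C)^-1 E C (1 - C)^-1]. The inverses are contractions
   because [(1 + C)^* (1 + C) = 1 + C^* C], so this difference has norm at most
   [2 ||C|| ||E|| = ||B|| ||E||], and Weyl's perturbation inequality applies to
   [A + E] and [A']. *)
Require Import Defs.
From HB Require Import structures.
From mathcomp Require Import all_boot all_order all_algebra.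
From mathcomp Require Import complex ring.
From mathcomp Require Import boolp classical_sets reals.

Set Implicit Arguments.
Unset Strict Implicit.
Unset Printing Implicit Defensive.

Import Order.TTheory GRing.Theory Num.Theory.
Local Open Scope ring_scope.
Local Open Scope complex_scope.
Local Open Scope sesquilinear_scope.

(** * Adjoints, similarity and homogeneous linear systems *)

Section Adjoint.
Variable C : numClosedFieldType.

Lemma adjmxM m n p (X : 'M[C]_(m, n)) (Y : 'M[C]_(n, p)) :
  (X *m Y) ^t* = Y ^t* *m X ^t*.
Proof. by rewrite trmx_mul map_mxM. Qed.

Lemma adjmxD m n (X Y : 'M[C]_(m, n)) : (X + Y) ^t* = X ^t* + Y ^t*.
Proof. by rewrite linearD /= map_mxD. Qed.

Lemma adjmxN m n (X : 'M[C]_(m, n)) : (- X) ^t* = - X ^t*.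
Proof. by rewrite linearN /= map_mxN. Qed.

Lemma adjmxB m n (X Y : 'M[C]_(m, n)) : (X - Y) ^t* = X ^t* - Y ^t*.
Proof. by rewrite linearB /= map_mxB. Qed.

Lemma adjmx1 n : (1%:M : 'M[C]_n) ^t* = 1%:M.
Proof. by rewrite trmx1 map_mx1. Qed.

Lemma adjmx_inv n (X : 'M[C]_n) : (invmx X) ^t* = invmx (X ^t*).
Proof. by rewrite trmx_inv map_invmx. Qed.

Lemma hermsymmx_adj n (X : 'M[C]_n) : X \is hermsymmx -> X ^t* = X.
Proof. by move/is_hermitianmxP; rewrite expr0 scale1r. Qed.

Lemma adj_hermsymmx n (X : 'M[C]_n) : X ^t* = X -> X \is hermsymmx.
Proof. by move=> XE; apply/is_hermitianmxP; rewrite expr0 scale1r. Qed.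

Lemma skewhermmx_adj n (X : 'M[C]_n) : X \is skewhermmx -> X ^t* = - X.
Proof.
by move/is_hermitianmxP; rewrite expr1 scaleN1r => {2}->; rewrite opprK.
Qed.

End Adjoint.

(** Scalar matrices commute with [Q], so [Q *m P = 1] lets [Q] and [P] be pulled out of the
    characteristic matrix, and their determinants multiply to 1. *)
Lemma char_poly_similar (F : fieldType) n (P Q X : 'M[F]_n) :
  Q *m P = 1%:M -> char_poly (Q *m X *m P) = char_poly X.
Proof.
move=> QP; have QP' : map_mx polyC Q *m map_mx polyC P = 1%:M.
  by rewrite -map_mxM QP map_mx1.
have -> : char_poly (Q *m X *m P)
    = \det (map_mx polyC Q *m char_poly_mx X *m map_mx polyC P).
  congr (\det _); rewrite /char_poly_mx mulmxBr mulmxBl -!map_mxM.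
  by rewrite scalar_mxC -[_%:M *m _ *m _]mulmxA QP' mulmx1.
by rewrite !det_mulmx mulrAC -det_mulmx QP' det1 mul1r.
Qed.

(** The conditions are [#|S| + #|T|] homogeneous linear equations in n unknowns. Their coefficients
    are the columns of [K], too few for [K] to have rank n. *)
Lemma exists_common_zero (F : fieldType) n (P Q : 'M[F]_n)
    (S T : pred 'I_n) : (#|S| + #|T| < n)%N ->
  exists2 v : 'rV[F]_n, v != 0 &
    (forall j, S j -> (v *m P) 0 j = 0) /\ (forall j, T j -> (v *m Q) 0 j = 0).
Proof.
move=> ltn.
pose K := row_mx (colsub (@enum_val _ S) P) (colsub (@enum_val _ T) Q).
have : kermx K != 0.
  rewrite kermx_eq0; apply/negP => /eqP rK.
  by have := rank_leq_col K; rewrite rK leqNgt ltn.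
case/rowV0Pn => v /sub_kermxP; rewrite mul_mx_row => vK v0; exists v => //.
have /eq_row_mx[v1 v2] : row_mx (v *m colsub (@enum_val _ S) P)
    (v *m colsub (@enum_val _ T) Q) = row_mx 0 0 by rewrite vK row_mx0.
split=> j Hj.
- have /rowP/(_ (enum_rank_in Hj j)) := v1.
  by rewrite mulmx_colsub [LHS]mxE [RHS]mxE enum_rankK_in.
- have /rowP/(_ (enum_rank_in Hj j)) := v2.
  by rewrite mulmx_colsub [LHS]mxE [RHS]mxE enum_rankK_in.
Qed.

(** * Euclidean norm, spectral norm, and perturbations of the identity by skew-Hermitian matrices *)

Section L2norm.
Context {R : realType}.
Implicit Types n : nat.

Lemma sqr_l2norm n (x : 'cV[R[i]]_n) :
  ((l2norm x)^+2)%:C = (x ^t* *m x) 0 0.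
Proof.
rewrite sqr_sqrtr; last by apply: sumr_ge0 => i _; exact: sqr_ge0.
rewrite rmorph_sum mxE; apply: eq_bigr => i _.
by rewrite !mxE rmorphXn mulrC; exact: sqr_normc.
Qed.

(** Identifies [l2norm] with the norm of the Hermitian form [dotmx] on row vectors, so that the
    triangle and Cauchy-Schwarz inequalities carry over. *)
Lemma sqrtC_dotmx n (x : 'cV[R[i]]_n) :
  sqrtC (dotmx (x ^t*) (x ^t*)) = (l2norm x)%:C.
Proof.
rewrite dotmxE trmxCK -sqr_l2norm rmorphXn /= sqrCK //.
by rewrite lecR l2norm_ge0.
Qed.

Lemma l2normD n (x y : 'cV[R[i]]_n) : l2norm (x + y) <= l2norm x + l2norm y.
Proof.
rewrite -lecR rmorphD /= -!sqrtC_dotmx adjmxD.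
by case: (triangle_lerif (@dotmx R[i] n) (x ^t*) (y ^t*)).
Qed.

Lemma l2normN n (x : 'cV[R[i]]_n) : l2norm (- x) = l2norm x.
Proof.
congr Num.sqrt; apply: eq_bigr => i _; rewrite mxE.
by case: (x i 0) => a b; rewrite /= !sqrrN.
Qed.

Lemma l2norm_adj_mulmx n (x y : 'cV[R[i]]_n) :
  `|(x ^t* *m y) 0 0| <= (l2norm x * l2norm y)%:C.
Proof.
rewrite rmorphM /= -!sqrtC_dotmx -{1}[y]trmxCK -dotmxE.
by case: (CauchySchwarz_sqrt (@dotmx R[i] n) (x ^t*) (y ^t*)).
Qed.

(** Skewness cancels the cross terms: the squared norm of [(1 + K) x] is that of [x] plus that of
    [K x]. *)
Lemma l2norm_le_1D_skew n (K : 'M[R[i]]_n) (x : 'cV[R[i]]_n) :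
  K ^t* = - K -> l2norm x <= l2norm ((1%:M + K) *m x).
Proof.
move=> KE; rewrite -(ler_pXn2r (ltn0Sn 1)) ?nnegrE ?l2norm_ge0 // -lecR.
rewrite !sqr_l2norm adjmxM adjmxD adjmx1 KE.
rewrite mulmxA -[_ *m _ *m (1%:M + K)]mulmxA.
have -> : (1%:M - K) *m (1%:M + K) = 1%:M + K ^t* *m K.
  by rewrite KE mulmxDr !mulmxBl !mul1mx mulmx1 mulNmx addrA subrK.
rewrite mulmxDr mulmx1 mulmxDl mulmxA -adjmxM -mulmxA [leRHS]mxE -sqr_l2norm.
by rewrite lerDl -sqr_l2norm lecR sqr_ge0.
Qed.

(** The preceding lower bound forces a trivial kernel. A row vector killed by [1 + K] has as adjoint
    a column killed by [1 - K], and [- K] is again skew. *)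
Lemma unitmx_1D_skew n (K : 'M[R[i]]_n) :
  K ^t* = - K -> 1%:M + K \in unitmx.
Proof.
move=> KE; rewrite -row_free_unit; apply: inj_row_free => v v0.
rewrite -[v]trmxCK; suff -> : v ^t* = 0 by rewrite linear0 map_mx0.
apply: l2norm_eq0; apply/le_anti; rewrite l2norm_ge0 andbT.
have NKE : (- K) ^t* = - - K by rewrite adjmxN KE.
apply: le_trans (l2norm_le_1D_skew _ NKE) _.
have -> : 1%:M - K = (1%:M + K) ^t* by rewrite adjmxD adjmx1 KE.
by rewrite -adjmxM v0 linear0 map_mx0 l2norm0.
Qed.

Lemma l2norm_invmx_1D_skew n (K : 'M[R[i]]_n) (x : 'cV[R[i]]_n) :
  K ^t* = - K -> l2norm (invmx (1%:M + K) *m x) <= l2norm x.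
Proof.
move=> KE; apply: le_trans (l2norm_le_1D_skew _ KE) _.
by rewrite mulKVmx // unitmx_1D_skew.
Qed.

Lemma specnorm_ge0 m n (M : 'M[R[i]]_(m, n)) : 0 <= specnorm M.
Proof.
apply: (ub_le_sup (specnorm_set_bounded M)).
by exists 0; rewrite /= ?mulmx0 l2norm0 ?ler01.
Qed.

Lemma specnormD m n (X Y : 'M[R[i]]_(m, n)) :
  specnorm (X + Y) <= specnorm X + specnorm Y.
Proof.
apply: specnorm_le => [|x].
  exact: addr_ge0 (specnorm_ge0 X) (specnorm_ge0 Y).
rewrite mulmxDl mulrDl; apply: le_trans (l2normD _ _) _.
exact: lerD (l2norm_mulmx X x) (l2norm_mulmx Y x).
Qed.

Lemma specnormZ_le m n (a : R[i]) (X : 'M[R[i]]_(m, n)) :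
  specnorm (a *: X) <= Normc.normc a * specnorm X.
Proof.
apply: specnorm_le => [|x].
  exact: mulr_ge0 (normc_ge0 a) (specnorm_ge0 X).
rewrite -scalemxAl l2normZ -mulrA.
exact: ler_wpM2l (normc_ge0 a) _ _ (l2norm_mulmx X x).
Qed.

Lemma specnormN m n (X : 'M[R[i]]_(m, n)) : specnorm (- X) = specnorm X.
Proof.
suff le (Y : 'M[R[i]]_(m, n)) : specnorm (- Y) <= specnorm Y.
  by apply: le_anti; rewrite (le X) -[X in specnorm X <= _]opprK (le (- X)).
apply: specnorm_le => [|x]; first exact: specnorm_ge0.
by rewrite mulNmx l2normN; exact: l2norm_mulmx.
Qed.

Lemma specnormM m n p (X : 'M[R[i]]_(m, n)) (Y : 'M[R[i]]_(n, p)) :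
  specnorm (X *m Y) <= specnorm X * specnorm Y.
Proof.
apply: specnorm_le => [|x].
  exact: mulr_ge0 (specnorm_ge0 X) (specnorm_ge0 Y).
rewrite -mulmxA -mulrA; apply: le_trans (l2norm_mulmx X _) _.
exact: ler_wpM2l (specnorm_ge0 X) _ _ (l2norm_mulmx Y x).
Qed.

Lemma specnorm_invmx_1D_skew n (K : 'M[R[i]]_n) :
  K ^t* = - K -> specnorm (invmx (1%:M + K)) <= 1.
Proof.
move=> KE; apply: specnorm_le => // x.
by rewrite mul1r; exact: l2norm_invmx_1D_skew.
Qed.

End L2norm.

(** * Weyl's perturbation inequality *)

Section Weyl.
Context {R : realType}.
Implicit Types n : nat.

(** Unitary diagonalization preserves the characteristic polynomial, and a product of monic linear
    factors determines its roots up to order. *)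
Lemma perm_eigenvalues_spectral n (M : 'M[R[i]]_n) : M \is hermsymmx ->
  perm_eq (eigenvalues M) (codom (spectral_diag M 0)).
Proof.
move=> Mh; apply: prod_XsubC_eq; rewrite -char_poly_eigenvalues.
have /hermitian_normalmx/orthomx_spectralP {1}-> := Mh.
rewrite char_poly_similar ?mulVmx ?spectral_unit //.
rewrite char_poly_trig ?diag_mx_is_trig // big_image /=.
by apply: eq_bigr => j _; rewrite mxE eqxx.
Qed.

(** Counting ignores order, so it passes between the unsorted spectral diagonal and the sorted list
    that defines [lambda]. *)
Lemma count_lambda n (M : 'M[R[i]]_n) (p : pred R) : M \is hermsymmx ->
  #|[pred j | p (complex.Re (spectral_diag M 0 j))]| =
  count p (sort <=%R [seq complex.Re z | z <- eigenvalues M]).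
Proof.
move=> Mh; rewrite (permP (permEl (perm_sort _ _))) count_map.
rewrite (permP (perm_eigenvalues_spectral Mh)) /codom /image_mem count_map.
rewrite cardE /enum_mem size_filter count_filter.
by apply: eq_count => j; rewrite /= andbT.
Qed.

(** With more than [i] entries below [lambda M i], the sorted entry at index [i] would be below
    itself. Repeated eigenvalues do no harm. *)
Lemma card_spectral_lt_lambda n (M : 'M[R[i]]_n) (i : 'I_n) :
  M \is hermsymmx ->
  (#|[pred j | complex.Re (spectral_diag M 0 j) < lambda M i]%R| <= i)%N.
Proof.
move=> Mh; rewrite (count_lambda (< lambda M i)%R Mh) leqNgt; apply/negP.
by move/(nth_count_lt 0 (sort_sorted (@le_total _ R) _)); rewrite ltxx.
Qed.

(** Otherwise at most [i] sorted entries are [<= lambda M i], and the entry at index [i] would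
    exceed itself. *)
Lemma card_spectral_gt_lambda n (M : 'M[R[i]]_n) (i : 'I_n) :
  M \is hermsymmx ->
  (#|[pred j | lambda M i < complex.Re (spectral_diag M 0 j)]%R| + i < n)%N.
Proof.
move=> Mh; rewrite (count_lambda (> lambda M i)%R Mh) ltnNge; apply/negP.
set s := sort _ _ => le; have ss : size s = n.
  by rewrite size_sort size_map size_eigenvalues.
have : (count (<= lambda M i)%R s <= i < size s)%N.
  by rewrite count_le_gt ss leq_subLR le ltn_ord.
by move/(nth_count_gt 0 (sort_sorted (@le_total _ R) _)); rewrite ltxx.
Qed.

Lemma spectral_quadratic_form n (M : 'M[R[i]]_n) (v : 'rV[R[i]]_n) :
  M \is hermsymmx ->
  (v *m M *m v ^t*) 0 0 = \sum_j (complex.Re (spectral_diag M 0 j))%:C *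
    `|(v *m (spectralmx M) ^t*) 0 j| ^+ 2.
Proof.
move=> Mh; have Dr := hermitian_spectral_diag_real Mh.
have /hermitian_normalmx/orthomx_spectralP {1}-> := Mh.
rewrite invmx_unitary ?spectral_unitarymx // !mulmxA -[_ *m v ^t*]mulmxA.
have -> : spectralmx M *m v ^t* = (v *m (spectralmx M) ^t*) ^t*.
  by rewrite adjmxM trmxCK.
rewrite mul_mx_diag mxE; apply: eq_bigr => j _; rewrite ![in LHS]mxE.
rewrite RRe_real ?(mxOverP Dr) // normCK mulrAC mulrC.
by rewrite !mxE.
Qed.

(** Unitary invariance of the norm, written in the eigenbasis of [M] so that it can be compared term
    by term with the quadratic form of [M]. *)
Lemma spectral_sqnorm n (M : 'M[R[i]]_n) (v : 'rV[R[i]]_n) :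
  (v *m v ^t*) 0 0 = \sum_j `|(v *m (spectralmx M) ^t*) 0 j| ^+ 2.
Proof.
have PU : (spectralmx M) ^t* *m spectralmx M = 1%:M.
  by rewrite -invmx_unitary ?spectral_unitarymx // mulVmx ?spectral_unit.
transitivity ((v *m (spectralmx M) ^t* *m (v *m (spectralmx M) ^t*) ^t*) 0 0).
  by rewrite [in RHS]adjmxM trmxCK mulmxA -[v *m _ *m _]mulmxA PU mulmx1.
by rewrite [LHS]mxE; apply: eq_bigr => j _; rewrite normCK !mxE.
Qed.

(* A nonzero vector in both the span of the eigenvectors of [X] with eigenvalue
   at least [lambda X i] and the span of those of [Y] with eigenvalue at most
   [lambda Y i] exists because the dimensions add up to at least n + 1. *)
Lemma lambda_le_specnorm n (X Y : 'M[R[i]]_n) (i : 'I_n) :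
  X \is hermsymmx -> Y \is hermsymmx ->
  lambda X i - lambda Y i <= specnorm (X - Y).
Proof.
move=> Xh Yh.
pose S := [pred j | complex.Re (spectral_diag X 0 j) < lambda X i].
pose T := [pred j | lambda Y i < complex.Re (spectral_diag Y 0 j)].
(* Indices start at 0: [S] has at most [i] elements and [T] fewer than [n - i]. *)
have ST : (#|S| + #|T| < n)%N.
  apply: leq_ltn_trans (card_spectral_gt_lambda i Yh).
  by rewrite addnC leq_add2l card_spectral_lt_lambda.
have [v v0 [vX vY]] :=
  exists_common_zero ((spectralmx X) ^t*) ((spectralmx Y) ^t*) ST.
pose x := v ^t*.
have xv : x ^t* = v by rewrite trmxCK.
have x0 : 0 < l2norm x.
  rewrite lt0r l2norm_ge0 andbT; apply: contraNneq v0 => /l2norm_eq0 x0.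
  by rewrite -xv x0 linear0 map_mx0.
(* The coordinates of [v] along eigenvectors with eigenvalue below [lambda X i] vanish; the other
   terms compare one by one. *)
have leX : (lambda X i)%:C * (v *m x) 0 0 <= (v *m X *m x) 0 0.
  rewrite spectral_quadratic_form // (spectral_sqnorm X) mulr_sumr.
  apply: ler_sum => j _.
  have [lt|le] := ltP (complex.Re (spectral_diag X 0 j)) (lambda X i).
    by rewrite vX // normr0 expr0n !mulr0.
  by rewrite ler_wpM2r ?exprn_ge0 // lecR.
have leY : (v *m Y *m x) 0 0 <= (lambda Y i)%:C * (v *m x) 0 0.
  rewrite spectral_quadratic_form // (spectral_sqnorm Y) mulr_sumr.
  apply: ler_sum => j _.
  have [lt|le] := ltP (lambda Y i) (complex.Re (spectral_diag Y 0 j)).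
    by rewrite vY // normr0 expr0n !mulr0.
  by rewrite ler_wpM2r ?exprn_ge0 // lecR.
have le : (lambda X i - lambda Y i)%:C * (v *m x) 0 0
    <= (x ^t* *m ((X - Y) *m x)) 0 0.
  rewrite rmorphB mulrBl xv mulmxA mulmxBr mulmxBl [leRHS]mxE.
  by rewrite [X in _ <= _ + X]mxE lerB.
have := l2norm_adj_mulmx x ((X - Y) *m x).
have xx : (v *m x) 0 0 = (l2norm x ^+ 2)%:C by rewrite sqr_l2norm xv.
(* A complex number comparable to a real one is real, hence at most its modulus. *)
have r : (x ^t* *m ((X - Y) *m x)) 0 0 \is Num.real.
  rewrite -(ler_real le) //.
  by rewrite xx -rmorphM; apply/complex_realP; eexists.
move/(le_trans (real_ler_norm r))/(le_trans le).
(* One factor [l2norm x] cancels against Cauchy-Schwarz, the other after bounding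
   [l2norm ((X - Y) *m x)] by the spectral norm. *)
rewrite xx -rmorphM lecR expr2 mulrA mulrC ler_pM2l //.
move/le_trans/(_ (l2norm_mulmx _ _)).
by rewrite ler_pM2r.
Qed.

Lemma weyl_lambda n (X Y : 'M[R[i]]_n) (i : 'I_n) :
  X \is hermsymmx -> Y \is hermsymmx ->
  `|lambda X i - lambda Y i| <= specnorm (X - Y).
Proof.
move=> Xh Yh; rewrite ler_norml lambda_le_specnorm // andbT lerNl opprB.
apply: le_trans (lambda_le_specnorm i Yh Xh) _.
by rewrite -opprB specnormN.
Qed.

End Weyl.

(** * The Cayley transform and the final estimate *)

Lemma normc_half (R : realType) : Normc.normc (2^-1 : R[i]) = 2^-1.
Proof.
by rewrite Normc.normcV /= addr0 expr0n addr0 sqrtr_sqr ger0_norm ?addr_ge0.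
Qed.

(** The error formula cleared of inverses: it becomes [A + E] minus the conjugate of [A] after
    multiplying by the inverse of [1 + C] on the left and of [1 - C] on the right. *)
Lemma cayley_identity (F : comNzRingType) n (A C E : 'M[F]_n) :
  E = (A *m C - C *m A) *+ 2 ->
  C *m E *m (1%:M - C) - E *m C =
  (1%:M + C) *m (A + E) *m (1%:M - C) - (1%:M - C) *m A *m (1%:M + C).
Proof.
move=> /matrixP Eij.
rewrite !(mulmxDl, mulmxDr, mulmxN, mulNmx, mul1mx, mulmx1).
(* Once expanded, the identity is linear in these words, so they can be treated as unrelated
   matrices and compared entrywise in the commutative ring [F]. *)
move: (C *m A *m C) (C *m E *m C) (C *m A) (A *m C) (C *m E) (E *m C) Eij.
move=> CAC CEC CA AC CE EC Eij; apply/matrixP => i j.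
by move: (Eij i j); rewrite !mxE => Eij'; ring: Eij'.
Qed.

Section Cayley.
Context {R : realType}.
Variables (n : nat) (A C E P Q : 'M[R[i]]_n).
Hypotheses (C_skew : C ^t* = - C) (PE : P = 1%:M + C) (QE : Q = 1%:M - C).

Let NC_skew : (- C) ^t* = - - C. Proof. by rewrite adjmxN C_skew. Qed.
Let Pu : P \in unitmx. Proof. by rewrite PE; exact: unitmx_1D_skew. Qed.
Let Qu : Q \in unitmx. Proof. by rewrite QE; exact: unitmx_1D_skew. Qed.
Let Padj : P ^t* = Q. Proof. by rewrite PE QE adjmxD adjmx1 C_skew. Qed.
Let Qadj : Q ^t* = P. Proof. by rewrite -Padj trmxCK. Qed.

(** [P] and [Q] commute, both being polynomials in [C]. *)
Lemma cayley_inverse : invmx P *m Q *m (P *m invmx Q) = 1%:M.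
Proof.
have PQ : P *m Q = Q *m P.
  rewrite PE QE !mulmxDl !mulmxDr !mul1mx !mulmx1 mulmxN mulNmx.
  exact: addrACA.
by rewrite mulmxA -(mulmxA _ Q) -PQ (mulKmx Pu) (mulmxV Qu).
Qed.

(** The adjoint exchanges [P] and [Q], so the two outer factors are adjoint to each other. *)
Lemma hermsymmx_cayley : A \is hermsymmx ->
  invmx P *m Q *m A *m (P *m invmx Q) \is hermsymmx.
Proof.
move/hermsymmx_adj => AE; apply: adj_hermsymmx.
by rewrite !adjmxM !adjmx_inv Padj Qadj AE !mulmxA.
Qed.

Lemma cayley_error : E = (A *m C - C *m A) *+ 2 ->
  A + E - invmx P *m Q *m A *m (P *m invmx Q) =
  invmx P *m (C *m E) - invmx P *m (E *m (C *m invmx Q)).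
Proof.
move=> EE; have := cayley_identity EE; rewrite -PE -QE => /(canLR (subrK _)).
move/(congr1 (fun X => invmx P *m X *m invmx Q)).
rewrite -(mulmxA P) (mulKmx Pu) (mulmxK Qu) => <-.
rewrite !(mulmxDr (invmx P)) !(mulmxDl _ _ (invmx Q)) mulmxN mulNmx.
rewrite !(mulmxA (invmx P)) (mulmxK Qu) !mulmxA.
by rewrite addrK.
Qed.

Lemma specnorm_cayley_error : E = (A *m C - C *m A) *+ 2 ->
  specnorm (A + E - invmx P *m Q *m A *m (P *m invmx Q))
    <= specnorm C * specnorm E *+ 2.
Proof.
move/cayley_error ->.
have c0 := specnorm_ge0 C; have e0 := specnorm_ge0 E.
have contractP k (X : 'M_(n, k)) : specnorm (invmx P *m X) <= specnorm X.
  apply: le_trans (specnormM _ _) _; apply: ler_piMl (specnorm_ge0 X) _.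
  by rewrite PE; exact: specnorm_invmx_1D_skew.
have Q1 : specnorm (invmx Q) <= 1 by rewrite QE; exact: specnorm_invmx_1D_skew.
apply: le_trans (specnormD _ _) _; rewrite specnormN mulr2n.
apply: lerD (le_trans (contractP _ _) _) (le_trans (contractP _ _) _).
  exact: specnormM.
apply: le_trans (specnormM _ _) _; rewrite [leRHS]mulrC.
apply: ler_wpM2l e0 _ _ _.
by apply: le_trans (specnormM _ _) _; exact: ler_piMr c0 Q1.
Qed.

End Cayley.

Theorem theorem6p1 (R : realType) (n : nat) (A B : 'M[R[i]]_n)
    (A_herm : A \is hermsymmx) (B_skew : B \is skewhermmx) :
  let E := A *m B - B *m A in
  E \is hermsymmx /\
  forall i : 'I_n,
    `|lambda (A + E) i - lambda A i| <= specnorm B * specnorm (A *m B - B *m A)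
    /\ specnorm B * specnorm (A *m B - B *m A) = specnorm B * specnorm E.
Proof.
move=> E; have AE := hermsymmx_adj A_herm; have BE := skewhermmx_adj B_skew.
have Eh : E \is hermsymmx.
  apply: adj_hermsymmx.
  by rewrite adjmxB !adjmxM AE BE mulNmx mulmxN opprK addrC.
split=> // i; split=> //; rewrite -/E.
(* Halving [B] makes [E] twice the commutator of [A] and [C], as the Cayley identity requires, and
   absorbs the factor 2 of the error bound. *)
have [C Cdef] : {C | C = 2^-1 *: B} by exists (2^-1 *: B).
have C_skew : C ^t* = - C.
  rewrite Cdef linearZ /= map_mxZ BE scalerN fmorphV; congr (- (_^-1 *: _)).
  exact: conjC_nat.
have EC : E = (A *m C - C *m A) *+ 2.
  rewrite Cdef -scalemxAl -scalemxAr -scalerBr -scaler_nat scalerA.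
  by rewrite divff ?scale1r // pnatr_eq0.
have C_norm : specnorm C *+ 2 <= specnorm B.
  have := specnormZ_le 2^-1 B.
  by rewrite -Cdef normc_half mulrC ler_pdivlMr ?ltr0n // mulr_natr.
(* [lambda] depends on its matrix only through the characteristic polynomial, which similarity
   preserves. *)
have lambdaA : lambda A i =
    lambda (invmx (1%:M + C) *m (1%:M - C) *m A *m
      ((1%:M + C) *m invmx (1%:M - C))) i.
  rewrite /lambda /eigenvalues char_poly_similar //.
  exact: cayley_inverse C_skew erefl erefl.
rewrite lambdaA; apply: le_trans (weyl_lambda i _ _) _.
- apply: adj_hermsymmx.
  by rewrite adjmxD AE; congr (_ + _); exact: hermsymmx_adj.
- exact: hermsymmx_cayley C_skew erefl erefl A_herm.
apply: le_trans (specnorm_cayley_error C_skew erefl erefl EC) _.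
rewrite -mulrnAl; exact: ler_wpM2r (specnorm_ge0 E) _ _ C_norm.
Qed.
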